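(* Let $A$ be a set and let $f:A\to A$ be a map. There exists a lattice structure $(A,\vee,\wedge)$ on the set $A$ such that $f$ is a lattice endomorphism of $(A,\vee,\wedge)$ if and only if $f$ has no proper cycles or $f$ has at least two fixed points.
   Context: A lattice structure $(A,\vee,\wedge)$ on a set $A$ is given by a partial order on $A$ in which any two elements $x,y$ have a least upper bound $x\vee y$ and a greatest lower bound $x\wedge y$ (equivalently, by two binary operations $\vee,\wedge$ on $A$ that are associative, commutative and satisfy the absorption laws $(x\vee y)\wedge y=y$ and $(x\wedge y)\vee y=y$). A map $f:A\to A$ is a lattice endomorphism of $(A,\vee,\wedge)$ if $f(x\vee y)=f(x)\vee f(y)$ and $f(x\wedge y)=f(x)\wedge f(y)$ for all $x,y\in A$ (no preservation of top or bottom elements is required, and the lattice need not be bounded). A cycle of length $n\geq 1$ with respect to $f$ is a list $x_1,\ldots,x_n$ of distinct elements of $A$ with $f(x_i)=x_{i+1}$ for $1\leq i\leq n-1$ and $f(x_n)=x_1$. A fixed point of $f$ is a cycle of length $1$, i.e. an element $x_1\in A$ with $f(x_1)=x_1$. A cycle is proper if it is not a fixed point, i.e. if its length is at least $2$. The set $A$ may be finite or infinite. *)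

(* Defs.v *)
From mathcomp Require Import all_boot all_order boolp.
Set Implicit Arguments.
Unset Strict Implicit.
Unset Printing Implicit Defensive.

(* [{classic A}] is [A] itself, equipped with the decidable equality that
   classical logic provides; [ufcycle f s] says that [s] has no repetition and
   that [f] sends each element of [s] to the next one, and the last to the
   first.  [ufcycle f [::]] holds, hence the condition on the size. *)
Definition is_cycle (A : Type) (f : A -> A) (s : seq A) : Prop :=
  0 < size s /\ ufcycle (f : {classic A} -> {classic A}) s.

Definition is_proper_cycle (A : Type) (f : A -> A) (s : seq A) : Prop :=
  is_cycle f s /\ 1 < size s.

Definition is_fixed_point (A : Type) (f : A -> A) (x : A) : Prop := f x = x.

(* [Order.Lattice d A] is the type of lattice structures on the carrier [A].
   Besides the partial order, join and meet it stores a decidable equality and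
   a choice operator on [A]; in classical logic every type has these, so they
   do not restrict [A]. The display [d] is a mere printing tag. *)
Definition lattice_structure (d : Order.disp_t) (A : Type) : Type :=
  Order.Lattice d A.

Definition is_lattice_endomorphism (d : Order.disp_t) (A : Type)
    (L : lattice_structure d A) (f : A -> A) : Prop :=
  let LA : latticeType d := Order.Lattice.Pack L in
  Order.join_morphism (f : LA -> LA) /\ Order.meet_morphism (f : LA -> LA).

(* Main.v *)
(* If [f] is a lattice endomorphism, it permutes the elements of a cycle, hence
   fixes both their join and their meet, which differ on a proper cycle.

   Conversely, call [x] and [y] synchronous if some iterate of [f] sends them to
   the same element; [f] induces an injection on synchronicity classes. Each
   class becomes a chain on which [f] is monotone: compare two elements, by a
   fixed total order on [A], through their last distinct iterates.
   It remains to order the classes.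
   - Without proper cycles the classes are ordered linearly: an element that
     meets a later iterate of another precedes it, and distinct components of
     the graph of [f] are put one after the other. The result is a chain.
   - With two fixed points [a] and [b], the class of [a] goes to the bottom with
     [a] as its maximum, the class of [b] to the top with [b] as its minimum, and
     the other classes are pairwise incomparable in between. Elements of
     distinct middle classes then have join [b] and meet [a], and so have their
     images because [f] is injective on classes. *)
Require Import Defs.
From HB Require Import structures.
From mathcomp Require Import all_boot all_order boolp.
From mathcomp Require Import wochoice.
Set Implicit Arguments.
Unset Strict Implicit.
Unset Printing Implicit Defensive.

Import Order.TTheory.

(** * Total orders on arbitrary types *)

Lemma exists_total_order (T : eqType) :
  exists R : rel T, [/\ antisymmetric R, transitive R & total R].
Proof.
have [R Rwo] := well_ordering_principle T.
have wo C : wo_chain R C by move=> A _; apply: Rwo.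
have Rtot : total R by move=> x y; apply: (wo_chainW (wo predT)).
have Rasym : antisymmetric R.
  by move=> x y; apply: (wo_chain_antisymmetric (wo predT)).
exists R; split=> // y x z Rxy Ryz.
(* Transitivity comes from the least element of {x, y, z}: if it is x, then [R x z]; if it is y,
   then x = y; if it is z, then y = z. *)
have [|m [[+ lbm] _]] := Rwo [in [:: x; y; z]].
  by exists x; rewrite !inE eqxx.
rewrite !inE => /or3P[] /eqP e; subst m.
- by apply: lbm; rewrite !inE eqxx !orbT.
- by rewrite (Rasym x y) // Rxy lbm // !inE eqxx.
- suff <- : y = z by [].
  by apply: Rasym; rewrite Ryz lbm // !inE eqxx orbT.
Qed.

(** Any total order will do, once [a] is moved to its bottom and [b] to its top. *)
Lemma exists_total_order_bounded (T : eqType) (a b : T) : a != b ->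
  exists R : rel T,
    [/\ antisymmetric R, transitive R, total R,
        forall x, R a x & forall x, R x b].
Proof.
move=> neq_ab; have [R [Rasym Rtr Rtot]] := exists_total_order T.
pose R' x y := [|| x == a, y == b | [&& x != b, y != a & R x y]].
exists R'; split; rewrite /R'.
- move=> x y /andP[/or3P[/eqP->|/eqP->|/and3P[xb ya Rxy]]].
  + by rewrite eqxx (negPf neq_ab) andbF !orbF => /eqP->.
  + by rewrite eqxx eq_sym (negPf neq_ab) orbF => /eqP->.
  + rewrite (negPf ya) (negPf xb) /= => /and3P[_ _ Ryx].
    by apply: Rasym; rewrite Rxy.
- move=> y x z /or3P[-> //|/eqP->|].
    by rewrite eqxx eq_sym (negPf neq_ab) /= orbF => ->; rewrite orbT.
  case/and3P=> xb ya Rxy; rewrite (negPf ya) /=.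
  case/orP=> [->|/and3P[yb za Ryz]]; first by rewrite orbT.
  by rewrite xb za (Rtr _ _ _ Rxy Ryz) !orbT.
- move=> x y; have := Rtot x y.
  by case: (x == a); case: (y == b); case: (y == a); case: (x == b).
- by move=> x; rewrite eqxx.
- by move=> x; rewrite eqxx orbT.
Qed.

(** * From orders with bounds to lattice structures *)

Section LatticeOfOrder.
Variables (A : Type) (f : A -> A) (le : A -> A -> Prop).

Definition is_lub (x y j : A) := forall z, le j z <-> le x z /\ le y z.
Definition is_glb (x y m : A) := forall z, le z m <-> le z x /\ le z y.

Hypotheses (le_refl : forall x, le x x)
  (le_anti : forall x y, le x y -> le y x -> x = y)
  (le_trans : forall x y z, le x y -> le y z -> le x z).

Lemma is_lub_inj x y j k : is_lub x y j -> is_lub x y k -> j = k.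
Proof.
by move=> Hj Hk; apply: le_anti; [apply/Hj/Hk|apply/Hk/Hj]; apply: le_refl.
Qed.

Lemma is_glb_inj x y j k : is_glb x y j -> is_glb x y k -> j = k.
Proof.
by move=> Hj Hk; apply: le_anti; [apply/Hk/Hj|apply/Hj/Hk]; apply: le_refl.
Qed.

(** A single witness [j] serves both for [x], [y] and, through [f j], for their images; uniqueness
    of bounds then turns this into preservation of the chosen joins and meets. *)
Lemma lattice_endomorphism_of_order :
  (forall x y, exists j, is_lub x y j /\ is_lub (f x) (f y) (f j)) ->
  (forall x y, exists m, is_glb x y m /\ is_glb (f x) (f y) (f m)) ->
  exists d (L : lattice_structure d A), is_lattice_endomorphism L f.
Proof.
move=> lubP glbP.
pose join x y : A := sval (cid (lubP x y)).
pose meet x y : A := sval (cid (glbP x y)).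
have joinP x y : is_lub x y (join x y) /\ is_lub (f x) (f y) (f (join x y)).
  exact: svalP (cid (lubP x y)).
have meetP x y : is_glb x y (meet x y) /\ is_glb (f x) (f y) (f (meet x y)).
  exact: svalP (cid (glbP x y)).
pose leb : rel {classic A} := fun x y => `[< le x y >].
have leb_refl : reflexive leb by move=> x; apply/asboolP.
have leb_anti : antisymmetric leb.
  by move=> x y /andP[/asboolP xy /asboolP yx]; apply: le_anti.
have leb_trans : transitive leb.
  by move=> y x z /asboolP xy /asboolP yz; apply/asboolP; apply: le_trans yz.
have leb_meet x y z : leb x (meet y z) = leb x y && leb x z.
  rewrite /leb -asbool_and; apply: asbool_equiv_eq.
  exact: (meetP y z).1.
have leb_join x y z : leb (join x y) z = leb x z && leb y z.
  rewrite /leb -asbool_and; apply: asbool_equiv_eq.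
  exact: (joinP x y).1.
pose d := Order.Disp tt tt.
pose P := Order.Le_isPOrder.Build d {classic A} leb_refl leb_anti leb_trans.
pose PT : porderType d := HB.pack {classic A} P.
pose M := Order.POrder_MeetJoin_isLattice.Build d PT leb_meet leb_join.
pose LT : latticeType d := HB.pack PT M.
exists d, (Order.Lattice.class LT); split=> x y /=.
- exact: is_lub_inj (joinP x y).2 (joinP _ _).1.
- exact: is_glb_inj (meetP x y).2 (meetP _ _).1.
Qed.

End LatticeOfOrder.

(** * Synchronicity classes and the chain on each class *)

Section Synchronous.
Variables (A : Type) (f : A -> A).

Definition sync (x y : A) := exists k, iter k f x = iter k f y.

Lemma iter_eq_leq k l x y :
  k <= l -> iter k f x = iter k f y -> iter l f x = iter l f y.
Proof. by move=> /subnK <- e; rewrite !iterD e. Qed.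

Lemma sync_refl x : sync x x.
Proof. by exists 0. Qed.

Lemma sync_sym x y : sync x y -> sync y x.
Proof. by case=> k e; exists k. Qed.

Lemma sync_trans x y z : sync x y -> sync y z -> sync x z.
Proof.
move=> [k e] [l e']; exists (maxn k l).
by rewrite (iter_eq_leq (leq_maxl k l) e) (iter_eq_leq (leq_maxr k l) e').
Qed.

Lemma sync_f x y : sync (f x) (f y) <-> sync x y.
Proof.
split=> -[k e]; first by exists k.+1; rewrite !iterSr.
by exists k; rewrite -!iterSr /= e.
Qed.

Lemma sync_fixed x y : f x = x -> f y = y -> sync x y -> x = y.
Proof. by move=> fx fy [k]; rewrite !iter_fix. Qed.

Variable R : rel A.

(* [k] is unique: the [k]-th iterates are the last distinct ones. *)
Definition merge_lt (x y : A) := exists k,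
  [/\ iter k.+1 f x = iter k.+1 f y, iter k f x <> iter k f y
    & R (iter k f x) (iter k f y)].

Lemma merge_lt_sync x y : merge_lt x y -> sync x y.
Proof. by case=> k [e _ _]; exists k.+1. Qed.

Lemma merge_lt_irr x : ~ merge_lt x x.
Proof. by case=> k [_ + _]. Qed.

(** Applying [f] lowers the index of the last distinct iterates by one; at index 0 the two images
    coincide. *)
Lemma merge_lt_homo x y : merge_lt x y -> f x = f y \/ merge_lt (f x) (f y).
Proof.
case=> -[|k] [e ne r]; first by left.
by right; exists k; rewrite -!iterSr.
Qed.

Hypotheses (Rasym : antisymmetric R) (Rtr : transitive R) (Rtot : total R).

(** The pair that merges later decides: by then the other pair has already merged, so one of its
    members may replace the other. For equal indices [R] is transitive, and its antisymmetry keeps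
    the iterates of [x] and [z] distinct. *)
Lemma merge_lt_trans x y z : merge_lt x y -> merge_lt y z -> merge_lt x z.
Proof.
move=> [k [exy nxy rxy]] [l [eyz nyz ryz]].
have [lt_kl|lt_lk|ekl] := ltngtP k l.
- have exy' := iter_eq_leq lt_kl exy.
  by exists l; split; rewrite ?exy' // (iter_eq_leq (leqW lt_kl) exy).
- have eyz' := iter_eq_leq lt_lk eyz.
  by exists k; split; rewrite -?eyz' // exy (iter_eq_leq (leqW lt_lk) eyz).
- subst l; exists k; split; [by rewrite exy | | exact: Rtr ryz].
  by move=> exz; apply: nyz; apply: Rasym; rewrite ryz -exz.
Qed.

Lemma merge_lt_total x y :
  sync x y -> [\/ x = y, merge_lt x y | merge_lt y x].
Proof.
case=> k; elim: k => [|k IHk] e; first by constructor 1.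
have [/IHk//|ne] := pselect (iter k f x = iter k f y).
have [r|r] := orP (Rtot (iter k f x) (iter k f y)).
  by constructor 2; exists k.
by constructor 3; exists k; split=> // /esym.
Qed.

(** * Sums of the chains along a strict order [S] on classes *)

Section ClassOrder.
Variable S : A -> A -> Prop.
Hypotheses (S_nsync : forall x y, S x y -> ~ sync x y)
  (S_trans : forall x y z, S x y -> S y z -> S x z)
  (S_syncl : forall x y z, sync x y -> S y z -> S x z)
  (S_syncr : forall x y z, S x y -> sync y z -> S x z)
  (S_homo : forall x y, S x y -> S (f x) (f y)).

Definition sum_le (x y : A) := [\/ x = y, S x y | merge_lt x y].

Lemma sum_le_refl x : sum_le x x.
Proof. by constructor 1. Qed.

Lemma sum_le_trans x y z : sum_le x y -> sum_le y z -> sum_le x z.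
Proof.
case=> [->//|Sxy|mxy] [<-|Syz|myz].
- by constructor 2.
- by constructor 2; apply: S_trans Syz.
- by constructor 2; apply: S_syncr Sxy _; apply: merge_lt_sync.
- by constructor 3.
- by constructor 2; apply: S_syncl Syz; apply: merge_lt_sync.
- by constructor 3; apply: merge_lt_trans myz.
Qed.

Lemma sum_le_anti x y : sum_le x y -> sum_le y x -> x = y.
Proof.
case=> [->//|Sxy|mxy] [->//|Syx|myx].
- by case: (S_nsync (S_trans Sxy Syx)); apply: sync_refl.
- by case: (S_nsync Sxy); apply/sync_sym/merge_lt_sync.
- by case: (S_nsync Syx); apply/sync_sym/merge_lt_sync.
- by case: (merge_lt_irr (merge_lt_trans mxy myx)).
Qed.

Lemma sum_le_homo x y : sum_le x y -> sum_le (f x) (f y).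
Proof.
case=> [->|/S_homo Sxy|/merge_lt_homo[->|mxy]].
- exact: sum_le_refl.
- by constructor 2.
- exact: sum_le_refl.
- by constructor 3.
Qed.

(** For comparable elements the bounds are the elements themselves, and [f] preserves them by
    monotonicity. Each class being a chain, only pairs from distinct, [S]-unrelated classes need an
    argument. *)
Lemma sum_lattice_endomorphism :
  (forall x y, ~ sync x y -> ~ S x y -> ~ S y x ->
    exists j m, [/\ is_lub sum_le x y j, is_lub sum_le (f x) (f y) (f j),
                    is_glb sum_le x y m & is_glb sum_le (f x) (f y) (f m)]) ->
  exists d (L : lattice_structure d A), is_lattice_endomorphism L f.
Proof.
move=> incomparable.
have lub x y : sum_le x y -> is_lub sum_le x y y /\ is_lub sum_le y x y.
  by move=> xy; split=> z; split=> [yz|[]//]; split=> //; apply: sum_le_trans yz.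
have glb x y : sum_le x y -> is_glb sum_le x y x /\ is_glb sum_le y x x.
  by move=> xy; split=> z; split=> [zx|[]//]; split=> //; apply: sum_le_trans xy.
have cmp x y : [\/ sum_le x y, sum_le y x |
                   [/\ ~ sync x y, ~ S x y & ~ S y x]].
  have [Sxy|nSxy] := pselect (S x y); first by constructor 1; constructor 2.
  have [Syx|nSyx] := pselect (S y x); first by constructor 2; constructor 2.
  have [/merge_lt_total|nxy] := pselect (sync x y); last by constructor 3.
  case=> [->|m|m]; first by constructor 1; apply: sum_le_refl.
    by constructor 1; constructor 3.
  by constructor 2; constructor 3.
apply: (lattice_endomorphism_of_order sum_le_refl sum_le_anti sum_le_trans).
- move=> x y; have [xy|yx|[n1 n2 n3]] := cmp x y.
  + by exists y; split; [case: (lub _ _ xy) | case: (lub _ _ (sum_le_homo xy))].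
  + by exists x; split; [case: (lub _ _ yx) | case: (lub _ _ (sum_le_homo yx))].
  + by have [j [m [? ? _ _]]] := incomparable _ _ n1 n2 n3; exists j.
- move=> x y; have [xy|yx|[n1 n2 n3]] := cmp x y.
  + by exists x; split; [case: (glb _ _ xy) | case: (glb _ _ (sum_le_homo xy))].
  + by exists y; split; [case: (glb _ _ yx) | case: (glb _ _ (sum_le_homo yx))].
  + by have [j [m [_ _ ? ?]]] := incomparable _ _ n1 n2 n3; exists m.
Qed.

End ClassOrder.

End Synchronous.

(** * Maps with two fixed points *)

Lemma lattice_of_two_fixed_points (A : Type) (f : A -> A) (a b : A) :
  a <> b -> f a = a -> f b = b ->
  exists d (L : lattice_structure d A), is_lattice_endomorphism L f.
Proof.
move=> neq_ab fa fb.
have nab : ~ sync f a b by move/(sync_fixed fa fb).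
have neq_ba : (b : {classic A}) != a by apply/eqP => /esym.
(* Here [b] is least and [a] greatest for [R], because [a] has to be the maximum of the bottom class
   and [b] the minimum of the top class. *)
have [R [Rasym Rtr Rtot Rb Ra]] := exists_total_order_bounded neq_ba.
pose S x y := (sync f x a /\ ~ sync f y a) \/ (~ sync f x b /\ sync f y b).
have syncCl x y z : sync f x y -> sync f x z -> sync f y z.
  by move=> xy; apply: sync_trans (sync_sym xy).
have nboth x : sync f x a -> sync f x b -> False by move=> xa /(syncCl _ _ _ xa).
have S_nsync x y : S x y -> ~ sync f x y.
  move=> [[xa ya]|[xb yb]] xy; first exact: ya (syncCl _ _ _ xy xa).
  exact: xb (sync_trans xy yb).
have S_trans x y z : S x y -> S y z -> S x z.
  move=> [[xa ya]|[xb yb]] [[ya' za]|[yb' zb]] //.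
  - by left; split=> // /nboth/(_ zb).
  - by case: (nboth _ ya' yb).
have S_syncl x y z : sync f x y -> S y z -> S x z.
  move=> xy [[ya za]|[yb zb]]; [left|right]; split=> //.
    exact: sync_trans ya.
  by move/(syncCl _ _ _ xy).
have S_syncr x y z : S x y -> sync f y z -> S x z.
  move=> [[xa ya]|[xb yb]] yz; [left|right]; split=> //.
    by move/(sync_trans yz).
  exact: syncCl yb.
have fE c : f c = c -> forall x, sync f (f x) c <-> sync f x c.
  by move=> fc x; rewrite -{1}fc; apply: sync_f.
have fEa := fE a fa; have fEb := fE b fb.
have S_homo x y : S x y -> S (f x) (f y).
  by rewrite /S !(propext (fEa _)) !(propext (fEb _)).
apply: (sum_lattice_endomorphism (R := R) Rasym Rtr Rtot
          S_nsync S_trans S_syncl S_syncr S_homo) => x y nxy nSxy nSyx.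
pose le := sum_le f R S.
have le_a z : sync f z a -> le z a.
  (* Descend to the last iterate of [z] that differs from [a]. The same iterate of [a] is [a]
     itself, the greatest element of [R]. *)
  case=> k; have [->|] := pselect (z = a); first by constructor 1.
  elim: k => //= k IHk ne e.
  have [|n] := pselect (iter k f z = iter k f a); first exact: IHk.
  by constructor 3; exists k; split=> //; rewrite (iter_fix k fa).
have le_b z : sync f z b -> le b z.
  case=> k; have [->|] := pselect (z = b); first by move=> _; apply: sum_le_refl.
  elim: k => //= k IHk ne e.
  have [|n] := pselect (iter k f z = iter k f b); first exact: IHk.
  constructor 3; exists k; split; [exact: esym | exact: nesym n |].
  by rewrite (iter_fix k fb).
have le_Sl z w : sync f z a -> ~ sync f w a -> le z w by constructor 2; left.
have le_Sr z w : ~ sync f z b -> sync f w b -> le z w by constructor 2; right.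
pose mid u v := [/\ ~ sync f u v, ~ sync f u a, ~ sync f v a,
                   ~ sync f u b & ~ sync f v b].
have mid_lub u v : mid u v -> is_lub le u v b.
  case=> nuv ua va ub vb z; split=> [bz|[uz vz]].
    have bb : sync f b b by apply: sync_refl.
    by split; apply: (sum_le_trans Rasym Rtr S_trans S_syncl S_syncr _ bz);
      apply: le_Sr.
  apply: le_b; apply: contrapT => zb.
  (* If [z] is outside the class of [b], an element below it that is outside the class of [a] must
     share its class. Both [u] and [v] would then lie in the class of [z]. *)
  have class_z w : ~ sync f w a -> le w z -> sync f w z.
    by move=> wa [->|[[/wa]|[_ /zb]]|] //; [exact: sync_refl|exact: merge_lt_sync].
  by apply: nuv (sync_trans (class_z _ ua uz) (sync_sym (class_z _ va vz))).
have mid_glb u v : mid u v -> is_glb le u v a.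
  case=> nuv ua va ub vb z; split=> [za|[zu zv]].
    have aa : sync f a a by apply: sync_refl.
    by split; apply: (sum_le_trans Rasym Rtr S_trans S_syncl S_syncr za);
      apply: le_Sl.
  apply: le_a; apply: contrapT => za.
  have class_z w : ~ sync f w b -> le z w -> sync f z w.
    by move=> wb [->|[[/za]|[_ /wb]]|] //; [exact: sync_refl|exact: merge_lt_sync].
  by apply: nuv (sync_trans (sync_sym (class_z _ ub zu)) (class_z _ vb zv)).
have mid_homo u v : mid u v -> mid (f u) (f v).
  by rewrite /mid !(propext (fEa _)) !(propext (fEb _)) (propext (sync_f f u v)).
have mid_xy : mid x y.
  split=> // h.
  - by apply: nSxy; left; split=> // ya; apply/nxy/(sync_trans h)/sync_sym.
  - by apply: nSyx; left; split=> // xa; apply/nxy/(sync_trans xa)/sync_sym.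
  - by apply: nSyx; right; split=> // yb; apply/nxy/(sync_trans h)/sync_sym.
  - by apply: nSxy; right; split=> // xb; apply/nxy/(sync_trans xb)/sync_sym.
have mid_fxy := mid_homo _ _ mid_xy.
by exists b, a; rewrite fa fb; split; auto.
Qed.

(** * Maps without proper cycles *)

Lemma periodic_proper_cycle (A : Type) (f : A -> A) (x : A) (p : nat) :
  0 < p -> iter p f x = x -> f x <> x -> exists s, is_proper_cycle f s.
Proof.
move=> p_gt0 xp fx.
pose g : {classic A} -> {classic A} := f; pose y : {classic A} := x.
have ex_p : exists p, (0 < p) && (iter p g y == y).
  by exists p; rewrite p_gt0; apply/eqP.
case: (ex_minnP ex_p) => -[//|q] /= /eqP yq qmin.
have q_gt0 : 0 < q by case: q yq {qmin} => // /fx.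
exists (traject g y q.+1); split; last by rewrite size_traject.
split; first by rewrite size_traject.
apply/andP; split.
  have := fpath_traject g y q.+1.
  by rewrite trajectSr -iterSr /= yq.
(* A repetition makes iterate [q] equal to an earlier iterate [i]; one more application of [f] gives
   the period [i.+1], below the minimal period [q.+1]. *)
rewrite looping_uniq; apply/negP => /trajectP[i lt_iq e].
have := qmin i.+1; rewrite /= -e yq eqxx.
by move=> /(_ isT); rewrite ltnS leqNgt lt_iq.
Qed.

Lemma lattice_of_no_proper_cycle (A : Type) (f : A -> A) :
  ~ (exists s, is_proper_cycle f s) ->
  exists d (L : lattice_structure d A), is_lattice_endomorphism L f.
Proof.
move=> acyclic.
have periodic_fixed p x : 0 < p -> iter p f x = x -> f x = x.
  move=> p0 xp; apply: contrapT => fx; apply: acyclic.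
  exact: periodic_proper_cycle p0 xp fx.
pose comp x y := exists m n, iter m f x = iter n f y.
have comp_sym x y : comp x y -> comp y x by move=> [m [n e]]; exists n, m.
have comp_trans x y z : comp x y -> comp y z -> comp x z.
  move=> [m [n e]] [p [q e']]; exists (p + m), (n + q).
  by rewrite !iterD e -e' -!iterD addnC.
have compE x y : comp x y -> comp x = comp y.
  move=> xy; apply/predeqP => z; split; last exact: comp_trans.
  exact/comp_trans/comp_sym.
have comp_refl x : comp x x by exists 0, 0.
have comp_f x : comp (f x) = comp x by apply: compE; exists 0, 1.
have sync_comp x y : sync f x y -> comp x = comp y.
  by move=> [k e]; apply: compE; exists k, k.
have [R [Rasym Rtr Rtot]] := exists_total_order {classic A}.
(* A component is represented by the predicate [comp x], so a total order on predicates orders the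
   components. *)
have [W [Wasym Wtr Wtot]] := exists_total_order {classic (A -> Prop)}.
pose later x y := exists m n, m < n /\ iter m f x = iter n f y.
pose S x y := (comp x <> comp y /\ W (comp x) (comp y)) \/
              (~ sync f x y /\ later x y).
have later_comp x y : later x y -> comp x = comp y.
  by move=> [m [n [_ e]]]; apply: compE; exists m, n.
have later_trans x y z : later x y -> later y z -> later x z.
  move=> [m [n [mn e]]] [p [q [pq e']]]; exists (p + m), (n + q); split.
    by rewrite addnC; rewrite -addSn leq_add // ltnW.
  by rewrite !iterD e -e' -!iterD addnC.
have later_syncl x y z : sync f x y -> later y z -> later x z.
  move=> [k e] [m [n [mn e']]]; exists (m + k), (n + k).
  by rewrite ltn_add2r !iterD e -!iterD addnC iterD e' -iterD addnC.
have later_syncr x y z : later x y -> sync f y z -> later x z.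
  move=> [m [n [mn e']]] [k e]; exists (k + m), (k + n).
  by rewrite ltn_add2l iterD e' -!iterD addnC iterD e -iterD addnC.
have later_f x y : later x y -> later (f x) (f y).
  by move=> [m [n [mn e]]]; exists m, n; split=> //; rewrite -!iterSr /= e.
(* Two synchronous elements at different heights force a cycle, hence a fixed
   point, and then the whole component is one class. *)
have collapse x y z : later x z -> sync f x z -> comp x = comp y -> sync f x y.
  move=> xz zx xy.
  have [m [n [lt_mn e]]] := later_syncr _ _ _ xz (sync_sym zx).
  have fw : f (iter m f x) = iter m f x.
    apply: (@periodic_fixed (n - m)); first by rewrite subn_gt0.
    by rewrite -iterD subnK // ltnW.
  have [p [q e']] : comp x y by rewrite xy.
  have qmy : iter (q + m) f y = iter m f x.
    by rewrite addnC iterD -e' -iterD addnC iterD iter_fix.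
  exists (q + m); rewrite qmy iterD iter_fix //.
have S_nsync x y : S x y -> ~ sync f x y by move=> [[+ _] /sync_comp|[]].
have S_trans x y z : S x y -> S y z -> S x z.
  move=> [[xy Wxy]|[xy lxy]] [[yz Wyz]|[yz lyz]].
  - left; split; last exact: Wtr Wyz.
    by move=> xz; apply: xy; apply: Wasym; rewrite Wxy xz.
  - by left; rewrite -(later_comp _ _ lyz).
  - by left; rewrite (later_comp _ _ lxy).
  (* Were [x] and [z] synchronous, [collapse] would make [x] and [y] synchronous too. *)
  - have lxz := later_trans _ _ _ lxy lyz.
    right; split=> // xz; apply: xy; apply: collapse lxz xz _.
    exact: later_comp.
have S_syncl x y z : sync f x y -> S y z -> S x z.
  move=> xy [[yz Wyz]|[yz lyz]]; first by left; rewrite (sync_comp _ _ xy).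
  right; split; last exact: later_syncl lyz.
  by move=> xz; apply: yz; apply: sync_trans xz; apply: sync_sym.
have S_syncr x y z : S x y -> sync f y z -> S x z.
  move=> [[xy Wxy]|[xy lxy]] yz; first by left; rewrite -(sync_comp _ _ yz).
  right; split; last exact: later_syncr yz.
  by move=> xz; apply: xy; apply: sync_trans xz _; apply: sync_sym.
have S_homo x y : S x y -> S (f x) (f y).
  rewrite /S !comp_f (propext (sync_f f x y)) => -[|[xy /later_f]].
    by left.
  by right.
apply: (sum_lattice_endomorphism (R := R) Rasym Rtr Rtot
          S_nsync S_trans S_syncl S_syncr S_homo) => x y nxy nSxy nSyx.
(* No two classes are unrelated: distinct components are compared by [W], and within one component
   iterates meet at unequal counts, giving [later], or at equal counts, giving synchronicity. *)
exfalso; have [xy|xy] := pselect (comp x = comp y); last first.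
  have [r|r] := orP (Wtot (comp x) (comp y)).
    by apply: nSxy; left.
  by apply: nSyx; left; split=> // /esym.
have [m [n e]] : comp x y by rewrite xy.
have [lt_mn|lt_nm|emn] := ltngtP m n.
- by apply: nSxy; right; split=> //; exists m, n.
- apply: nSyx; right; split; first by move=> yx; apply/nxy/sync_sym.
  by exists n, m.
- by apply: nxy; exists m; rewrite e emn.
Qed.

(** * Fixed points from a proper cycle *)

Lemma map_fcycle (T : eqType) (f : T -> T) (s : seq T) :
  fcycle f s -> map f s = rot 1 s.
Proof.
(* The induction varies the starting point of the path but keeps the closing entry [x]. *)
case: s => //= x s; rewrite rot1_cons; elim: s {1 3}x => [|y s IHs] z /=.
  by rewrite andbT => /eqP->.
by case/andP=> /eqP-> /IHs->.
Qed.

(** The image of the fold is the fold of the rotated list, and rotation does not change a fold of an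
    associative commutative operation. The head [x] is the seed, as a lattice may lack bounds. *)
Lemma foldr_rot1_fixed (T : Type) (op : T -> T -> T) (f : T -> T) x s :
  associative op -> commutative op -> {morph f : x y / op x y} ->
  map f (x :: s) = rot 1 (x :: s) -> f (foldr op x s) = foldr op x s.
Proof.
move=> opA opC fM.
have foldr_f z t : f (foldr op z t) = foldr op (f z) (map f t).
  by elim: t => //= y t <-.
have foldrM y z t : foldr op (op y z) t = op y (foldr op z t).
  by elim: t => //= w t ->; rewrite opA (opC w) -opA.
rewrite foldr_f rot1_cons; case: s => [[->] //|y s [-> fs]].
by rewrite [map f (y :: s)]fs foldr_rcons opC foldrM.
Qed.

Lemma foldr_join_ge (d : Order.disp_t) (L : latticeType d) (x : L) s :
  (x <= foldr Order.join x s)%O.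
Proof. by elim: s => //= y s /le_trans->//; apply: leUr. Qed.

Lemma foldr_meet_le (d : Order.disp_t) (L : latticeType d) (x : L) s :
  (foldr Order.meet x s <= x)%O.
Proof. by elim: s => //= y s; apply: le_trans; apply: leIr. Qed.

Lemma two_fixed_points_of_proper_cycle d (A : Type) (L : lattice_structure d A)
    (f : A -> A) (s : seq A) :
  is_lattice_endomorphism L f -> is_proper_cycle f s ->
  exists x y : A, x <> y /\ is_fixed_point f x /\ is_fixed_point f y.
Proof.
pose LA : latticeType d := Order.Lattice.Pack L.
move=> [fU fI] [[_ /andP[/map_fcycle fs us]]].
case: s us fs => [|x [|y s]] //= /andP[+ _] fs _; rewrite inE negb_or.
move=> /andP[/eqP neq_xy _].
pose j : LA := foldr Order.join (x : LA) (y :: s).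
pose m : LA := foldr Order.meet (x : LA) (y :: s).
exists j, m; split; last split.
(* If [j = m], then [x <= j = m <= y] and [y <= j = m <= x]. *)
- move=> ejm; apply: neq_xy; apply: (@le_anti _ LA); apply/andP; split.
    apply: le_trans (foldr_join_ge (x : LA) (y :: s)) _.
    by rewrite -/j ejm; apply: leIl.
  apply: le_trans (foldr_meet_le (x : LA) (y :: s)).
  by rewrite -/m -ejm; apply: leUl.
- exact: (@foldr_rot1_fixed LA _ f x (y :: s) (@joinA _ LA) (@joinC _ LA) fU fs).
- exact: (@foldr_rot1_fixed LA _ f x (y :: s) (@meetA _ LA) (@meetC _ LA) fI fs).
Qed.

Theorem mainTheorem1 (A : Type) (f : A -> A) :
  (exists (d : Order.disp_t) (L : lattice_structure d A),
     is_lattice_endomorphism L f) <->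
  (~ (exists s : seq A, is_proper_cycle f s) \/
   (exists x y : A, x <> y /\ is_fixed_point f x /\ is_fixed_point f y)).
Proof.
split=> [[d [L fL]]|[|[a [b [neq_ab [fa fb]]]]]].
- have [[s fs]|] := pselect (exists s, is_proper_cycle f s); last by left.
  by right; apply: two_fixed_points_of_proper_cycle fL fs.
- exact: lattice_of_no_proper_cycle.
- exact: lattice_of_two_fixed_points neq_ab fa fb.
Qed.
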